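(* For all $\Delta\in\{5,6,7,8\}$, for all $\epsilon$ with $0<\epsilon<\Delta-4$, and for all sufficiently large $n>n(\Delta,\epsilon)$, there exists a $\Delta$-regular $n$-vertex graph $G$ with $$\mathsf{sl}(G)>n^{(\Delta-4-\epsilon)/4}.$$
   Context: Graphs are undirected, finite and simple. For a set $P\subseteq\mathbb{R}^2$ of points in the plane and a set $S\subset\mathbb{R}\cup\{\infty\}$ of slopes, $G(P,S)$ is the graph with vertex set $P$ in which two distinct points $v,w\in P$ are adjacent if and only if the slope of the line $\overline{vw}$ is in $S$. The slope parameter $\mathsf{sl}(G)$ of a graph $G$ is the minimum integer $k$ such that $G\cong G(P,S)$ for some point set $P$ and slope set $S$ with $|S|=k$. Here $n(\Delta,\epsilon)$ denotes a threshold depending only on $\Delta$ and $\epsilon$.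
   Formalization: The formal theorem restricts to sufficiently large n for which Δn is even, because for odd Δ and odd n no Δ-regular n-vertex graph exists (the degree sum would be odd). *)

(* Defs.v *)
From HB Require Import structures.
From mathcomp Require Import all_boot all_order all_algebra finmap.
From mathcomp Require Import boolp reals exp.
From mathcomp Require Import zify.

Set Implicit Arguments.
Unset Strict Implicit.
Unset Printing Implicit Defensive.

Import Order.TTheory GRing.Theory Num.Theory.
Local Open Scope ring_scope.

Record sgraph := SGraph {
  vertex :> finType;
  adj : rel vertex;
  adj_sym : symmetric adj;
  adj_irrefl : irreflexive adj }.

Definition regular (d : nat) (G : sgraph) : Prop :=
  forall v : G, #|[set w | adj v w]| = d.

Definition sgraph_iso (G H : sgraph) : Prop :=
  exists2 f : G -> H, bijective f & forall v w, adj (f v) (f w) = adj v w.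

Section SlopeGraph.
Variable R : realType.

(* An element of R u {oo} is an [option R], with [None] as oo. The value on
   the diagonal v = w, where no line is determined, is never used. *)
Definition slope (v w : R * R) : option R :=
  if v.1 == w.1 then None else Some ((w.2 - v.2) / (w.1 - v.1)).

Lemma slopeC v w : slope v w = slope w v.
Proof.
rewrite /slope eq_sym; case: eqP => // _.
by rewrite -(opprB v.2) -(opprB v.1) invrN mulrNN.
Qed.

Section Graph.
Variables (P : {fset (R * R)}) (S : {fset option R}).

Definition slope_adj : rel P :=
  [rel v w | (v != w) && (slope (val v) (val w) \in S)].

Lemma slope_adj_sym : symmetric slope_adj.
Proof. by move=> v w; rewrite /slope_adj /= eq_sym slopeC. Qed.

Lemma slope_adj_irrefl : irreflexive slope_adj.
Proof. by move=> v; rewrite /slope_adj /= eqxx. Qed.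

Definition slope_graph : sgraph := SGraph slope_adj_sym slope_adj_irrefl.

End Graph.

Definition drawable_with (G : sgraph) (k : nat) : Prop :=
  exists (P : {fset (R * R)}) (S : {fset option R}),
    #|` S|%fset = k /\ sgraph_iso G (slope_graph P S).

Lemma pow2_sum_inj (i j k l : nat) : (i < j)%N -> (k < l)%N ->
  (2 ^ i + 2 ^ j = 2 ^ k + 2 ^ l)%N -> i = k /\ j = l.
Proof.
have lt_sum a b c d : (a < b)%N -> (b < d)%N ->
    (2 ^ a + 2 ^ b < 2 ^ c + 2 ^ d)%N.
  move=> ab bd; have: (2 ^ a < 2 ^ b)%N by rewrite ltn_exp2l.
  have: (2 ^ b.+1 <= 2 ^ d)%N by rewrite leq_exp2l.
  by rewrite expnS; lia.
move=> ij kl e; case: (ltngtP j l) => [jl|lj|ejl].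
- by have := lt_sum i j k l ij jl; rewrite e ltnn.
- by have := lt_sum k l i j kl lj; rewrite e ltnn.
- by subst l; split=> //; apply: (@expnI 2) => //; lia.
Qed.

(* Points (2^i, 4^i) on a parabola determine pairwise distinct slopes
   2^i + 2^j, so every graph has a drawing. *)
Lemma drawable_exists (G : sgraph) : exists k, `[< drawable_with G k >].
Proof.
pose r (x : G) : nat := enum_rank x.
pose pt (x : G) : R * R := ((2 ^ r x)%:R, ((2 ^ r x) ^ 2)%:R).
have r_inj : injective r by move=> x y /val_inj /enum_rank_inj.
have slE x y : x != y -> slope (pt x) (pt y) = Some (2 ^ r x + 2 ^ r y)%:R.
  move=> xy; have ne : (2 ^ r y)%:R != (2 ^ r x)%:R :> R.
    by rewrite eqr_nat eqn_exp2l // (inj_eq r_inj) eq_sym.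
  rewrite /slope /= eq_sym (negPf ne) natrD.
  rewrite [((2 ^ r y) ^ 2)%:R]natrX [((2 ^ r x) ^ 2)%:R]natrX subr_sqr mulrC.
  by rewrite mulKf ?subr_eq0 // addrC.
have pt_inj : injective pt.
  by move=> ? ? [/eqP]; rewrite eqr_nat eqn_exp2l // => /eqP /r_inj.
have sl_inj x y x' y' : x != y -> x' != y' ->
    slope (pt x) (pt y) = slope (pt x') (pt y') ->
    (x = x' /\ y = y') \/ (x = y' /\ y = x').
  move=> xy xy'; rewrite !slE // => -[/eqP]; rewrite eqr_nat => /eqP e.
  have: r x != r y by rewrite (inj_eq r_inj).
  have: r x' != r y' by rewrite (inj_eq r_inj).
  case: (ltngtP (r x) (r y)) => // h1 + _.
    case: (ltngtP (r x') (r y')) => // h2 _.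
      by have [/r_inj-> /r_inj->] := pow2_sum_inj h1 h2 e; left.
    rewrite [RHS]addnC in e.
    by have [/r_inj-> /r_inj->] := pow2_sum_inj h1 h2 e; right.
  rewrite addnC in e.
  case: (ltngtP (r x') (r y')) => // h2 _.
    by have [/r_inj-> /r_inj->] := pow2_sum_inj h1 h2 e; right.
  rewrite [RHS]addnC in e.
  by have [/r_inj-> /r_inj->] := pow2_sum_inj h1 h2 e; left.
pose P := [fset pt x | x in G]%fset.
pose S := [fset slope (pt p.1) (pt p.2)
             | p in [pred p : G * G | adj p.1 p.2]]%fset.
exists #|` S|%fset; apply/asboolP; exists P, S; split=> //.
have ptP x : pt x \in P by apply/imfsetP; exists x.
pose f (x : G) : slope_graph P S := [` ptP x]%fset.
have f_inj : injective f by move=> x y /(congr1 val) /pt_inj.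
exists f.
  apply: inj_card_bij => //=.
  rewrite -cardfE /P; apply: leq_trans (leq_imfset_card _ _ _) _.
  by rewrite -cardE max_card.
move=> x y; rewrite /= /slope_adj /= (inj_eq f_inj).
have [<-|xy] := eqVneq x y; first by rewrite adj_irrefl.
apply/imfsetP/idP => /= [[[x' y']]|axy]; last by exists (x, y).
move=> h; have axy' : adj x' y' := h.
have xy' : x' != y' by apply: contraTneq axy' => ->; rewrite adj_irrefl.
by case/(sl_inj _ _ _ _ xy xy') => -[-> ->] //; rewrite adj_sym.
Qed.

Definition sl (G : sgraph) : nat := ex_minn (drawable_exists G).

End SlopeGraph.

(* Main.v *)
Require Import Defs.
From mathcomp Require Import all_boot all_order all_algebra.
From mathcomp Require Import reals exp.
From mathcomp Require Import all_fingroup finmap boolp sequences.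
From mathcomp Require Import zify ring lra.

(* A counting argument. If a graph on n labelled vertices is drawn with k
   slopes, adjacency of v and w is the vanishing of the product over the slopes
   (p_l, q_l) of p_l (y_w - y_v) - q_l (x_w - x_v), a polynomial in 2n + 2k
   variables. To each graph attach the product of these polynomials over its
   non-adjacent pairs: for an inclusion-free family of graphs these products,
   evaluated at the drawings, are linearly independent
   (Ronyai-Babai-Ganapathy), so the family is no larger than the number of
   monomials of the relevant multidegree, (2nk+1)^(2n) (n^2+1)^(2k).
   On the other hand, replacing each edge of K_{d,d} by an arbitrary permutation
   of 'I_m gives (m!)^(d^2) d-regular graphs on 2dm vertices; with a disjoint
   d-regular graph on O(1) vertices this is n^(dn/2 - o(n)) graphs on n
   vertices, which exceeds the bound when k <= n^((d - 4 - eps) / 4). *)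

Set Implicit Arguments.
Unset Strict Implicit.
Unset Printing Implicit Defensive.

Import Order.TTheory GRing.Theory Num.Theory.

(** * Regular graphs: disjoint unions, lifts of [K_{d,d}], circulants *)

Section DisjointUnion.
Variables G H : sgraph.

Definition dunion_adj : rel (G + H) := fun v w => match v, w with
  | inl x, inl y | inr x, inr y => adj x y
  | _, _ => false end.

Lemma dunion_adj_sym : symmetric dunion_adj.
Proof. by move=> [x|x] [y|y] //=; rewrite adj_sym. Qed.

Lemma dunion_adj_irrefl : irreflexive dunion_adj.
Proof. by move=> [x|x] /=; rewrite adj_irrefl. Qed.

Definition dunion : sgraph := SGraph dunion_adj_sym dunion_adj_irrefl.

Lemma dunion_regular d : regular d G -> regular d H -> regular d dunion.
Proof.
move=> Gd Hd [x|x] /=; [rewrite -(Gd x)|rewrite -(Hd x)].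
  rewrite -(card_imset _ (@inl_inj G H)); apply: eq_card => y.
  rewrite inE; case: y => y /=; first by rewrite mem_imset ?inE //;
    apply: inl_inj.
  by symmetry; apply/imsetP => -[].
rewrite -(card_imset _ (@inr_inj G H)); apply: eq_card => y.
rewrite inE; case: y => y /=; last by rewrite mem_imset ?inE //; apply: inr_inj.
by symmetry; apply/imsetP => -[].
Qed.

End DisjointUnion.

Section Lift.
Variables d m : nat.
Variable s : {ffun 'I_d * 'I_d -> 'S_m}.

(** The [m]-fold permutation lift of [K_{d,d}]: each vertex [i] of either side becomes a fibre of
    [m] vertices, each edge [(i, j)] the perfect matching [s (i, j)] between two fibres. *)
Definition lift_adj : rel ('I_d * 'I_m + 'I_d * 'I_m) :=
  fun v w => match v, w with
  | inl (i, x), inr (j, y) | inr (j, y), inl (i, x) => s (i, j) x == y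
  | _, _ => false end.

Lemma lift_adj_sym : symmetric lift_adj.
Proof. by move=> [[i x]|[i x]] [[j y]|[j y]]. Qed.

Lemma lift_adj_irrefl : irreflexive lift_adj.
Proof. by move=> [[i x]|[i x]]. Qed.

Definition lift_graph : sgraph := SGraph lift_adj_sym lift_adj_irrefl.

Lemma lift_graph_regular : regular d lift_graph.
Proof.
move=> [[i x]|[j y]] /=; rewrite -[RHS]card_ord.
  rewrite -cardsT.
  have f_inj : injective (fun j : 'I_d => inr (j, s (i, j) x) : lift_graph).
    by move=> j j' [].
  rewrite -(card_imset _ f_inj); apply: eq_card => v; rewrite inE.
  apply/idP/imsetP => /= [|[j _ ->]]; last by rewrite /= eqxx.
  by case: v => -[j y] //= /eqP <-; exists j.
rewrite -cardsT.
have f_inj : injective (fun i : 'I_d =>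
    inl (i, (s (i, j))^-1%g y) : lift_graph).
  by move=> i i' [].
rewrite -(card_imset _ f_inj); apply: eq_card => v; rewrite inE.
apply/idP/imsetP => /= [|[i _ ->]]; last by rewrite /= permKV eqxx.
by case: v => -[i x] //= /eqP <-; exists i; rewrite // permK.
Qed.

End Lift.

(** A vertex has exactly one neighbour in each opposite fibre, so inclusion already forces the
    permutations to agree: the lifts form an inclusion-free family. *)
Lemma lift_adj_inj d m (s t : {ffun 'I_d * 'I_d -> 'S_m}) :
  subrel (lift_adj s) (lift_adj t) -> s = t.
Proof.
move=> st; apply/ffunP => -[i j]; apply/permP => x.
by have /eqP := st (inl (i, x)) (inr (j, s (i, j) x)) (eqxx _).
Qed.

Section Circulant.
Variables (r : nat) (D : pred nat).

Definition circ_dist (i j : nat) : nat :=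
  minn (maxn i j - minn i j) (r - (maxn i j - minn i j)).

Definition circ_adj : rel 'I_r := fun i j => (i != j) && D (circ_dist i j).

Lemma circ_adj_sym : symmetric circ_adj.
Proof.
by move=> i j; rewrite /circ_adj /circ_dist eq_sym (maxnC i) (minnC i).
Qed.

Lemma circ_adj_irrefl : irreflexive circ_adj.
Proof. by move=> i; rewrite /circ_adj eqxx. Qed.

Definition circulant : sgraph := SGraph circ_adj_sym circ_adj_irrefl.

(** Regularity is reduced to a boolean test on lists of naturals, which evaluates for concrete
    parameters. *)
Lemma circulant_regular d :
  all (fun i => count (fun j => (i != j) && D (circ_dist i j)) (iota 0 r) == d)
    (iota 0 r) -> regular d circulant.
Proof.
move=> /allP h v; have vr : val v \in iota 0 r by rewrite mem_iota ltn_ord.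
  rewrite -(eqP (h _ vr)) {h vr}.
  rewrite -val_enum_ord count_map enumT cardsE cardE /enum_mem size_filter.
  exact: eq_count.
Qed.

End Circulant.

(** In a circulant, the distances [1] to [d./2] give two neighbours each, since [d < r]; for odd
    [d], [r] is even and the antipode at distance [r./2] is the last neighbour. *)
Lemma small_regular_graph d r : d \in [:: 5; 6; 7; 8] -> d < r <= 3 * d ->
  ~~ odd (d * r) -> exists2 G : sgraph, #|G| = r & regular d G.
Proof.
move=> d58 dr odr.
exists (circulant r (fun i => (i <= d./2) || odd d && (i == r./2))).
  by rewrite /= card_ord.
apply: circulant_regular; move: d58 dr odr.
(* As [d <= 8], [r] is at most 24, which leaves finitely many pairs to evaluate. *)
have [r25|] := ltnP r 25; last by rewrite !inE; lia.
have : all (fun d => all (fun r =>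
    [&& d < r, r <= 3 * d & ~~ odd (d * r)] ==>
    all (fun i => count (fun j => (i != j) &&
      ((circ_dist r i j <= d./2) || odd d && (circ_dist r i j == r./2)))
      (iota 0 r) == d) (iota 0 r)) (iota 0 25)) [:: 5; 6; 7; 8].
  by vm_compute.
move=> /allP h /h {h} /allP /(_ r); rewrite mem_iota.
move=> /(_ r25) /implyP h dr odr.
by apply: h; rewrite andbA dr.
Qed.

Local Open Scope ring_scope.

(** * Polynomial functions of bounded multidegree *)

Section MultidegreeBound.
Variables (F : fieldType) (V : finType).

Definition monom (e : {ffun V -> nat}) (u : V -> F) : F := \prod_v u v ^+ e v.

(** A polynomial is kept as the function it induces. Separate bounds per variable let coordinates
    and slopes contribute different factors to the monomial count. *)
Definition multidegree_le (d : V -> nat) (f : (V -> F) -> F) : Prop :=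
  exists2 s : seq (F * {ffun V -> nat}),
    (forall t, t \in s -> forall v, t.2 v <= d v)%N &
    forall u, f u = \sum_(t <- s) t.1 * monom t.2 u.

Lemma multidegree_leW d1 d2 f : (forall v, d1 v <= d2 v)%N ->
  multidegree_le d1 f -> multidegree_le d2 f.
Proof.
move=> d12 [s sd fE]; exists s => // t ts v.
by apply: leq_trans (d12 v); apply: sd.
Qed.

Lemma multidegree_le1 d : multidegree_le d (fun=> 1).
Proof.
exists [:: (1, [ffun=> 0%N])] => [t /[!inE] /eqP-> v|u]; first by rewrite ffunE.
by rewrite big_seq1 mul1r /monom big1 // => v _; rewrite ffunE.
Qed.

Lemma multidegree_le_var v : multidegree_le (fun w => v == w) (fun u => u v).
Proof.
exists [:: (1, [ffun w => nat_of_bool (v == w)])] => [t /[!inE] /eqP-> w|u].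
  by rewrite ffunE.
rewrite big_seq1 mul1r /monom (bigD1 v) //= ffunE eqxx big1 ?mulr1 // => w.
by rewrite ffunE eq_sym => /negPf->.
Qed.

Lemma multidegree_leD d f g : multidegree_le d f -> multidegree_le d g ->
  multidegree_le d (fun u => f u + g u).
Proof.
move=> [s sd fE] [t td gE]; exists (s ++ t) => [x|u].
  by rewrite mem_cat => /orP[/sd|/td].
by rewrite big_cat /= fE gE.
Qed.

Lemma multidegree_leN d f : multidegree_le d f ->
  multidegree_le d (fun u => - f u).
Proof.
move=> [s sd fE]; exists [seq (- t.1, t.2) | t <- s].
  by move=> _ /mapP[t /sd ht ->].
by move=> u; rewrite fE big_map -sumrN; apply: eq_bigr => t _; rewrite mulNr.
Qed.

Lemma multidegree_leM d1 d2 f g :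
  multidegree_le d1 f -> multidegree_le d2 g ->
  multidegree_le (fun v => d1 v + d2 v)%N (fun u => f u * g u).
Proof.
move=> [s sd fE] [t td gE].
exists [seq (x.1 * y.1, [ffun v => (x.2 v + y.2 v)%N])
        | x : F * {ffun V -> nat} <- s, y : F * {ffun V -> nat} <- t].
  by move=> _ /allpairsP[[x y] [/sd xd /td yd ->]] v; rewrite ffunE leq_add.
move=> u; rewrite fE gE big_allpairs_dep big_distrlr /=.
apply: eq_bigr => x _; apply: eq_bigr => y _.
rewrite mulrACA; congr (_ * _); rewrite /monom -big_split /=.
by apply: eq_bigr => v _; rewrite ffunE exprD.
Qed.

(** The bound sums over all of [I], not only over [P], so that products over the non-edges of
    different graphs share one multidegree. *)
Lemma multidegree_le_prod (I : finType) (P : pred I) (d : I -> V -> nat)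
    (f : I -> (V -> F) -> F) :
  (forall i, multidegree_le (d i) (f i)) ->
  multidegree_le (fun v => \sum_i d i v)%N (fun u => \prod_(i | P i) f i u).
Proof.
move=> fd.
have [s sd fE] : multidegree_le (fun v => \sum_(i <- index_enum I) d i v)%N
    (fun u => \prod_(i <- index_enum I | P i) f i u).
  elim: (index_enum I) => [|i r IHr].
    have [s sd fE] := multidegree_le1 (fun=> 0%N).
    by exists s => [t /sd h v|u]; rewrite big_nil // -fE.
  have [s sd fE] : multidegree_le (fun v => d i v + \sum_(j <- r) d j v)%N
      (fun u => (if P i then f i u else 1) * \prod_(j <- r | P j) f j u).
    apply: multidegree_leM => //.
    by case: (P i) => //; apply: multidegree_le1.
  exists s => [t /sd h v|u]; first by rewrite big_cons.
  by rewrite -fE big_cons; case: ifP => // _; rewrite mul1r.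
by exists s.
Qed.

(* The matrix (g a (u b)) is diagonal and invertible, and factors through the
   evaluations of the \prod_v (d v).+1 admissible monomials at the points u. *)
Lemma multidegree_card_le (I : finType) (d : V -> nat)
    (g : I -> (V -> F) -> F) (u : I -> V -> F) :
  (forall a, multidegree_le d (g a)) ->
  (forall a b, (g a (u b) != 0) = (a == b)) ->
  (#|I| <= \prod_v (d v).+1)%N.
Proof.
move=> gd gu.
pose D := {dffun forall v, 'I_(d v).+1}.
pose E : 'M[F]_(#|D|, #|I|) := \matrix_(i, j)
  monom [ffun v => nat_of_ord ((enum_val i : D) v)] (u (enum_val j)).
pose M : 'M[F]_(#|I|) := \matrix_(i, j) g (enum_val i) (u (enum_val j)).
have M_unit : M \in unitmx.
  have -> : M = diag_mx (\row_i g (enum_val i) (u (enum_val i))).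
    apply/matrixP => i j; rewrite !mxE; have [->|ij] := eqVneq; first by [].
    apply/eqP/negPn; rewrite gu.
    by apply: contra_neqN ij => /eqP/enum_val_inj.
  rewrite unitmxE det_diag unitfE; apply/prodf_neq0 => i _.
  by rewrite mxE gu.
have cardD : #|D| = (\prod_v (d v).+1)%N.
  rewrite card_dep_ffun foldrE big_image /=.
  by apply: eq_bigr => v _; rewrite card_ord.
rewrite -cardD -(mxrank_unit M_unit).
apply: leq_trans (rank_leq_row E); apply: mxrankS.
apply/row_subP => i; have [s sd gE] := gd (enum_val i).
have -> : row i M = \sum_(t <- s) t.1 *: \row_j monom t.2 (u (enum_val j)).
  apply/rowP => j; rewrite !mxE gE summxE; apply: eq_bigr => t _.
  by rewrite !mxE.
rewrite big_seq; apply: summx_sub => t ts; apply: scalemx_sub.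
pose e : D := [ffun v => inord (t.2 v)].
have -> : \row_j monom t.2 (u (enum_val j)) = row (enum_rank e) E.
  apply/rowP => j; rewrite !mxE enum_rankK; apply: eq_bigr => v _.
  by rewrite !ffunE inordK // ltnS; apply: sd.
exact: row_sub.
Qed.

End MultidegreeBound.

(** * Counting graphs drawn with few slopes *)

Section FewSlopes.
Variables (R : realType) (T : finType).

(* The slope q l / p l is in homogeneous form, p l = 0 standing for oo. *)
Definition few_slopes (k : nat) (e : rel T) : Prop :=
  exists (x y : T -> R) (p q : 'I_k -> R), forall v w, v != w ->
    e v w <-> exists l, p l * (y w - y v) = q l * (x w - x v).

(** The exponents [2 * #|T|] and [2 * k] count coordinate and slope variables. Over all ordered
    pairs, a vertex occurs [2 * #|T|] times, each time in [k] factors, and a slope occurs once per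
    pair. *)
Lemma few_slopes_card_le (I : finType) (e : I -> rel T) (k : nat) :
  (forall a, irreflexive (e a)) -> (forall a, few_slopes k (e a)) ->
  (forall a b, subrel (e a) (e b) -> a = b) ->
  (#|I| <= (2 * #|T| * k).+1 ^ (2 * #|T|) * (#|T| ^ 2).+1 ^ (2 * k))%N.
Proof.
move=> e_irr e_few e_sub.
(* The four summands index the variables [x], [y], [p], [q], in this order. *)
pose V := ((T + T) + ('I_k + 'I_k))%type.
have /choice[u uP] a : exists z : V -> R, forall v w, v != w ->
    e a v w <-> exists l, z (inr (inl l)) *
        (z (inl (inr w)) - z (inl (inr v))) =
      z (inr (inr l)) * (z (inl (inl w)) - z (inl (inl v))).
  have [x [y [p [q xypq]]]] := e_few a.
  by exists (fun z => match z with
    | inl (inl v) => x v | inl (inr v) => y v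
    | inr (inl l) => p l | inr (inr l) => q l end).
pose factor (vw : T * T) (l : 'I_k) (z : V -> R) :=
  z (inr (inl l)) * (z (inl (inr vw.2)) - z (inl (inr vw.1))) -
  z (inr (inr l)) * (z (inl (inl vw.2)) - z (inl (inl vw.1))).
pose nonadj a := [pred vw : T * T | (vw.1 != vw.2) && ~~ e a vw.1 vw.2].
pose g a (z : V -> R) := \prod_(vw | nonadj a vw) \prod_l factor vw l z.
pose delta (vw : T * T) (l : 'I_k) (z : V) : nat := match z with
  | inl (inl t) | inl (inr t) => ((vw.1 == t) + (vw.2 == t))%N
  | inr (inl i) | inr (inr i) => l == i end.
pose d (z : V) := (\sum_vw \sum_l delta vw l z)%N.
have term_deg (p x y : V) b :
    (forall z, (p == z) + ((x == z) + (y == z)) <= b z)%N ->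
    multidegree_le b (fun z : V -> R => z p * (z y - z x)).
  move=> le_b; apply: multidegree_leW le_b _.
  apply: multidegree_leM; first exact: multidegree_le_var.
  apply: multidegree_leD; last apply: multidegree_leN.
    by apply: multidegree_leW (multidegree_le_var _ _) => z; rewrite leq_addl.
  by apply: multidegree_leW (multidegree_le_var _ _) => z; rewrite leq_addr.
have factor_deg vw l : multidegree_le (delta vw l) (factor vw l).
  apply: multidegree_leD; last apply: multidegree_leN; apply: term_deg.
    by case=> [[t|t]|[i|i]]; rewrite /delta /= ?addn0.
  by case=> [[t|t]|[i|i]]; rewrite /delta /= ?addn0.
have g_deg a : multidegree_le d (g a).
  by apply: multidegree_le_prod => vw; apply: multidegree_le_prod.
have factor_neq0 a v w : v != w ->
    (\prod_l factor (v, w) l (u a) != 0) = ~~ e a v w.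
  move=> vw; apply/idP/idP => [/prodf_neq0 h|].
    by apply/negP => /(uP _ _ _ vw)[l /eqP]; rewrite -subr_eq0 (negPf (h l _)).
  move=> nvw; apply/prodf_neq0 => l _; apply: contra nvw; rewrite subr_eq0.
  by move=> /eqP h; apply/(uP _ _ _ vw); exists l.
(* [g a] is nonzero at the drawing of [b] exactly when every non-edge of [a] is a non-edge of [b],
   that is, when [e b] is included in [e a]. *)
have gu a b : (g a (u b) != 0) = (a == b).
  apply/idP/eqP => [/prodf_neq0 h|->].
    symmetry; apply: e_sub => v w bvw.
    have vw : v != w by apply: contraTneq bvw => ->; rewrite e_irr.
    apply: contraTT bvw => avw; rewrite -(factor_neq0 _ _ _ vw).
    by apply: h; rewrite /= vw.
  by apply/prodf_neq0 => -[v w] /andP[/= vw bvw]; rewrite factor_neq0.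
apply: leq_trans (multidegree_card_le g_deg gu) _.
have sumT (t : T) : (\sum_(vw : T * T) \sum_(l < k)
    ((vw.1 == t) + (vw.2 == t)) = 2 * #|T| * k)%N.
  under eq_bigr do rewrite sum_nat_const card_ord mulnC.
  rewrite -big_distrl /= big_split /=; congr (_ * _)%N.
  have eqT : (\sum_(s : T) (s == t) = 1)%N.
    by rewrite (bigD1 t) //= eqxx big1 // => s /negPf->.
  rewrite mul2n -addnn; congr addn.
    rewrite -(pair_bigA _ (fun v w : T => nat_of_bool (v == t))) /=.
    under eq_bigr do rewrite sum_nat_const.
    by rewrite -big_distrr /= eqT muln1.
  rewrite -(pair_bigA _ (fun v w : T => nat_of_bool (w == t))) /=.
  by under eq_bigr do rewrite eqT; rewrite sum1_card.
have sumk (i : 'I_k) : (\sum_(vw : T * T) \sum_(l < k) (l == i) = #|T| ^ 2)%N.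
  rewrite [LHS]sum_nat_const (bigD1 i) //= eqxx big1 => [|s /negPf->] //.
  by rewrite muln1 card_prod expnS expn1.
have dT z : d (inl z) = (2 * #|T| * k)%N by case: z => t; exact: sumT.
have dk z : d (inr z) = (#|T| ^ 2)%N by case: z => i; exact: sumk.
rewrite big_sumType /=; under eq_bigr do rewrite dT.
under [X in (_ * X)%N]eq_bigr do rewrite dk.
by rewrite !prod_nat_const !card_sum card_ord !addnn !mul2n.
Qed.

End FewSlopes.

Lemma sl_few_slopes (R : realType) (G : sgraph) (k : nat) :
  (exists v w : G, adj v w) -> (sl R G <= k)%N -> few_slopes R k (@adj G).
Proof.
rewrite /sl; case: ex_minnP => j /asboolP[P [S [Sj [f [g fK gK] fadj]]]] _.
move=> [v0 [w0]]; rewrite -fadj => /andP[_ /=].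
set s0 := slope _ _ => s0S jk.
pose dir (a : option R) : R * R := if a is Some b then (1, b) else (0, 1).
(* When [S] has fewer than [k] slopes the list is padded with [s0], the slope of an edge and so
   already in [S]; padding creates no adjacency. *)
pose s (l : 'I_k) := nth s0 S l.
exists (fun v => (val (f v)).1), (fun v => (val (f v)).2).
exists (fun l => (dir (s l)).1), (fun l => (dir (s l)).2) => v w vw.
have fvw : val (f v) != val (f w).
  by rewrite (inj_eq val_inj) (inj_eq (can_inj fK)).
have dirP a : (dir a).1 * ((val (f w)).2 - (val (f v)).2) =
    (dir a).2 * ((val (f w)).1 - (val (f v)).1) <->
    slope (val (f v)) (val (f w)) = a.
  move: (val (f v)) (val (f w)) fvw => [x y] [x' y'] /=.
  rewrite xpair_eqE /slope /=; have [<-|xx'] := eqVneq x x'; last move=> _.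
    rewrite /= => yy'; rewrite subrr mulr0; case: a => [a|] /=; last first.
      by split; rewrite ?mul0r.
    by split=> // /eqP; rewrite mul1r subr_eq0 eq_sym (negPf yy').
  have dx : x' - x != 0 by rewrite subr_eq0 eq_sym.
  case: a => [a|] /=.
    split=> [|[<-]]; last by rewrite mul1r divfK.
    by rewrite mul1r => ->; rewrite mulfK.
  by split=> // /eqP; rewrite mul0r mul1r eq_sym (negPf dx).
rewrite -fadj /= /slope_adj /= (inj_eq (can_inj fK)) vw /=.
split=> [slS|[l /dirP ->]]; last first.
  rewrite /s; have [lS|lS] := ltnP l (size S); first exact: mem_nth.
  by rewrite nth_default.
have lk : (index (slope (val (f v)) (val (f w))) S < k)%N.
  by apply: leq_trans jk; rewrite -Sj index_mem.
by exists (Ordinal lk); apply/dirP; rewrite /s /= nth_index.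
Qed.

(** * Asymptotic estimates *)

(** The bound [m! >= (m/e)^m], by induction from [m * ln (1 + 1/m) <= 1]. *)
Lemma ln_fact_ge (R : realType) (m : nat) :
  m%:R * ln m%:R - m%:R <= ln m`!%:R :> R.
Proof.
elim: m => [|m IHm]; first by rewrite mul0r subr0 ln1.
have [->|m_gt0] := posnP m; first by rewrite ln1 mulr0 sub0r oppr_le0.
have M_gt0 : 0 < m%:R :> R by rewrite ltr0n.
rewrite factS natrM lnM ?posrE ?ltr0n ?fact_gt0 //.
have : ln (m.+1%:R / m%:R) <= m%:R^-1 :> R.
  rewrite -natr1 mulrDl mul1r divff ?gt_eqF // le_ln1Dx //.
  by rewrite (lt_trans (ltrN10 _)) ?invr_gt0.
rewrite ln_div ?posrE ?ltr0n // => /(ler_wpM2l (ltW M_gt0)).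
rewrite divff ?gt_eqF // -natr1.
move: IHm; rewrite mulrDl; lra.
Qed.

(* With [c < 1] the factor [(x^2+1)^(2 x^c)] is only [exp(O(x))]: writing
   [x = exp L], one has [exp ((c-1) L) <= 1 / (1 + (1-c) L)]. *)
Lemma powR_ln_le (R : realType) (c x : R) : c < 1 -> 1 <= x ->
  x `^ c * (1 + 2 * ln x) <= (1 + 2 / (1 - c)) * x.
Proof.
move=> c1 x1; have x0 : 0 < x by apply: lt_le_trans x1.
have L0 : 0 <= ln x by apply: ln_ge0.
have d0 : 0 < 1 - c by rewrite subr_gt0.
have xE : x `^ c * (1 + (1 - c) * ln x) <= x.
  have {3}-> : x = x `^ c * x `^ (1 - c).
    by rewrite -powRD ?subrKC ?powRr1 ?gt_eqF ?implybT ?ltW.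
  rewrite ler_wpM2l ?powR_ge0 // /powR gt_eqF //.
  exact: expR_ge1Dx.
apply: le_trans (ler_wpM2l _ xE); last by rewrite addr_ge0 // divr_ge0 // ltW.
rewrite mulrCA ler_wpM2l ?powR_ge0 //.
set q := 2 / (1 - c); set w := (1 - c) * _.
have qw : q * w = 2 * ln x by rewrite /q /w mulrA divfK ?gt_eqF.
have -> : (1 + q) * (1 + w) = 1 + w + q + q * w by ring.
have : 0 <= q by rewrite divr_ge0 // ltW.
have : 0 <= w by rewrite mulr_ge0 // ltW.
rewrite qw; lra.
Qed.

(** In logarithms, with [N = n] and [L = ln n], the right side is at least [d N L / 2 - O(N)] and
    the left at most [2 (1 + c) N L + O(N)], where [2 (1 + c) = (d - eps) / 2]. The gap
    [eps N L / 2] absorbs the linear terms. *)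
Lemma few_slopes_lt_lifts (R : realType) (d : nat) (eps : R) :
  (4 < d <= 8)%N -> 0 < eps < d%:R - 4 ->
  exists n0 : nat, forall n m r k : nat, (n0 < n)%N ->
    n = (2 * d * m + r)%N -> (r <= 3 * d)%N ->
    k%:R <= n%:R `^ ((d%:R - 4 - eps) / 4) ->
    ((2 * n * k).+1 ^ (2 * n) * (n ^ 2).+1 ^ (2 * k) < m`! ^ (d ^ 2))%N.
Proof.
move=> /andP[d4 d8] /andP[eps_gt0 eps_lt].
set c := (_ / 4).
have c_lt1 : c < 1.
  have : d%:R <= 8 :> R by rewrite ler_nat.
  rewrite /c; lra.
have c_gt0 : 0 < c by rewrite /c; lra.
pose K := 1 + 2 / (1 - c).
have K_gt0 : 0 < K by rewrite /K addr_gt0 // divr_gt0 // subr_gt0.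
(* The linear terms total [228 + 2 * K]: 128 and 96 from the factorial (using [L <= N]), 4 from
   [lt1] and [2 * K] from [lt2]. One more unit gives strictness. *)
pose L0 := 32 + 2 * (229 + 2 * K) / eps.
exists (Num.truncn (expR L0) + 48)%N => n m r k n0n nE rd kc.
have n49 : (48 < n)%N by apply: leq_ltn_trans n0n; apply: leq_addl.
have n_gt0 : (0 < n)%N by apply: leq_trans n49.
pose N : R := n%:R; pose L := ln N; pose M : R := m%:R; pose D : R := d%:R.
have N_ge1 : 1 <= N by rewrite ler1n.
have N_gt0 : 0 < N by rewrite ltr0n.
have L_gt : L0 < L.
  rewrite -(expRK L0) ltr_ln ?posrE ?expR_gt0 //.
  have /andP[_ h] := truncn_itv (ltW (expR_gt0 L0)).
  by apply: lt_le_trans h _; rewrite ler_nat; lia.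
have [D5 D8] : 5 <= D /\ D <= 8 by rewrite !ler_nat.
have N48 : 48 <= N by rewrite ler_nat ltnW.
have m_gt0 : (0 < m)%N
  by case: (posnP m) => // m0; move: nE n49 rd d8; rewrite m0; clear; lia.
have NE : N = 2 * D * M + r%:R by rewrite /N nE natrD !natrM.
have r0 : 0 <= r%:R :> R by [].
have rD : r%:R <= 3 * D by rewrite /D -natrM ler_nat.
have L_32 : 32 <= L.
  apply: ltW; apply: le_lt_trans L_gt; rewrite /L0 lerDl divr_ge0 ?ltW //; lra.
have L_big : 229 + 2 * K <= eps * L / 2.
  have : 2 * (229 + 2 * K) / eps <= L by move: L_gt; rewrite /L0; lra.
  rewrite ler_pdivrMr //; lra.
have L_N : L <= N.
  have := @le_ln1Dx R (N - 1); rewrite subrKC => h.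
  by apply: le_trans (h _) _; lra.
(* [N <= 16 * M + 24] and [N >= 48] give [N / 32 <= M]. *)
have lnM_ge : L - 31 <= ln M.
  have h32 : ln 32 <= 31 :> R.
    have -> : 32 = 1 + 31 :> R by lra.
    by apply: le_ln1Dx; lra.
  have : ln (N / 32) <= ln M.
    rewrite ler_ln ?posrE ?divr_gt0 ?ltr0n //.
    have : 0 <= M by [].
    nra.
  rewrite ln_div ?posrE //; rewrite -/L; lra.
have fact_ge : D * N * L / 2 - 128 * N - 96 * L <= (d ^ 2)%:R * ln m`!%:R.
  have h1 : D ^+ 2 * (M * ln M - M) <= (d ^ 2)%:R * ln m`!%:R.
    by rewrite natrX; apply: ler_wpM2l (ln_fact_ge _ _); rewrite exprn_ge0.
  (* The loss is [D * r / 2 <= 3 * D ^+ 2 / 2 <= 96]. *)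
  have D2M : D * N / 2 - 96 <= D ^+ 2 * M by rewrite NE; nra.
  have : (D * N / 2 - 96) * (L - 32) <= D ^+ 2 * M * (ln M - 1).
    apply: ler_pM => //; try lra; nra.
  nra.
have nc_ge1 : 1 <= N `^ c by rewrite -(powRr0 N) ler_powR // ltW.
have lt1 : (2 * n)%:R * ln (2 * n * k).+1%:R <= 2 * N * (2 + (1 + c) * L).
  rewrite natrM ler_wpM2l ?mulr_ge0 //.
  apply: (@le_trans _ _ (ln (3 * (N * N `^ c)))).
    rewrite ler_ln ?posrE ?ltr0n ?mulr_gt0 ?powR_gt0 //.
    rewrite -natr1 !natrM -/N; nra.
  rewrite !lnM ?posrE ?mulr_gt0 ?powR_gt0 // ln_powR -/L.
  have : ln 3 <= 2 :> R.
    have -> : 3 = 1 + 2 :> R by lra.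
    by apply: le_ln1Dx; lra.
  lra.
have lt2 : (2 * k)%:R * ln (n ^ 2).+1%:R <= 2 * (K * N).
  apply: le_trans (ler_wpM2l _ (powR_ln_le c_lt1 N_ge1)) => //.
  rewrite natrM -mulrA ler_wpM2l //.
  apply: ler_pM => //; first by apply: ln_ge0; rewrite ler1n.
  apply: (@le_trans _ _ (ln (2 * N ^+ 2))).
    rewrite ler_ln ?posrE ?ltr0n ?mulr_gt0 ?exprn_gt0 //.
    rewrite -natr1 natrX -/N; nra.
  rewrite lnM ?posrE ?exprn_gt0 // lnXn // -/L.
  have : ln 2 <= 1 :> R.
    have -> : 2 = 1 + 1 :> R by lra.
    by apply: le_ln1Dx; lra.
  rewrite mulr_natl; lra.
have e0 : (0 < (2 * n * k).+1 ^ (2 * n) * (n ^ 2).+1 ^ (2 * k))%N.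
  by rewrite muln_gt0 !expn_gt0.
rewrite -(ltr_nat R) -ltr_ln ?posrE ?ltr0n ?expn_gt0 ?fact_gt0 //.
rewrite natrM !natrX lnM ?posrE ?exprn_gt0 ?ltr0n ?fact_gt0 //.
rewrite !lnXn ?ltr0n ?fact_gt0 // -!(mulr_natl (ln _)).
apply: le_lt_trans (lerD lt1 lt2) _; apply: lt_le_trans fact_ge.
have -> : 1 + c = (D - eps) / 4 by rewrite /c -/D; lra.
have : N * (229 + 2 * K) <= N * (eps * L / 2) by rewrite ler_wpM2l // ltW.
nra.
Qed.

Theorem theorem5 (R : realType) (Delta : nat) (epsilon : R) :
  Delta \in [:: 5; 6; 7; 8]%N ->
  0 < epsilon < Delta%:R - 4 ->
  exists n0 : nat, forall n : nat, (n > n0)%N -> ~~ odd (Delta * n) ->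
    exists G : sgraph,
      [/\ #|G| = n, regular Delta G &
          (sl R G)%:R > n%:R `^ ((Delta%:R - 4 - epsilon) / 4)].
Proof.
move=> D58 eps_bnd; have Dbnd : (4 < Delta <= 8)%N by rewrite !inE in D58; lia.
have [n0 few_lt] := few_slopes_lt_lifts Dbnd eps_bnd.
exists (n0 + 4 * Delta)%N => n n0n oddn.
(* Shifting by [Delta.+1] before dividing leaves a remainder [r > Delta], enough vertices for a
   [Delta]-regular graph. *)
pose m := ((n - Delta.+1) %/ (2 * Delta))%N.
pose r := ((n - Delta.+1) %% (2 * Delta) + Delta.+1)%N.
have nE : n = (2 * Delta * m + r)%N.
  by rewrite /r addnA [(_ * m)%N]mulnC -divn_eq subnK //; lia.
have r_bnd : (Delta < r <= 3 * Delta)%N.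
  have := @ltn_pmod (n - Delta.+1) (2 * Delta); rewrite /r; lia.
have [|H Hr Hreg] := small_regular_graph D58 r_bnd.
  by move: oddn; rewrite nE mulnDr oddD !oddM /= andbF.
pose Gr s := dunion (@lift_graph Delta m s) H.
have cardG s : #|Gr s| = n.
  by rewrite /= card_sum Hr card_sum !card_prod !card_ord nE; lia.
have regG s : regular Delta (Gr s).
  by apply: dunion_regular => //; apply: lift_graph_regular.
set c := (_ / 4).
apply: contrapT => noG.
(* As [sl] is an integer, [sl <= n^c] amounts to [sl <= k]. *)
pose k := Num.truncn (n%:R `^ c : R).
have kc : k%:R <= n%:R `^ c by rewrite /k truncn_le powR_ge0.
have few s : few_slopes R k (@adj (Gr s)).
  apply: sl_few_slopes.
    have : (0 < #|Gr s|)%N by rewrite cardG; lia.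
    case/card_gt0P => v _; exists v.
    have : (0 < #|[set w | adj v w]|)%N by rewrite regG; lia.
    by case/card_gt0P => w; rewrite inE; exists w.
  rewrite /k truncn_ge_nat ?powR_ge0 //.
  rewrite leNgt; apply/negP => lt_sl; apply: noG.
  by exists (Gr s).
have : (#|{ffun 'I_Delta * 'I_Delta -> 'S_m}| <=
    (2 * n * k).+1 ^ (2 * n) * (n ^ 2).+1 ^ (2 * k))%N.
  (* The vertex type of [Gr s] is the same for all [s]; the identity permutations merely name it. *)
  have := @few_slopes_card_le R (Gr [ffun=> 1%g]) _ (fun s => @adj (Gr s)) k.
  rewrite cardG; apply=> // [s v|s t st]; first exact: (@adj_irrefl (Gr s)).
  by apply: lift_adj_inj => v w; apply: (st (inl v) (inl w)).
rewrite leqNgt => /negP; apply.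
rewrite card_ffun card_prod card_ord.
have -> : #|{: 'S_m}| = m`! by rewrite -[RHS]card_Sn; apply: eq_card.
by rewrite mulnn; apply: few_lt nE _ kc; lia.
Qed.
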